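(* Let $G$ be a finitely generated virtually nilpotent group, i.e. there exists a nilpotent subgroup $H$ of $G$ with finite index. Let $T$ be a continuous action of $G$ on a compact metric space $(X,d)$. If there exists an element $g\in G$ such that the homeomorphism $T_g$ is expansive and has the pseudo-orbit tracing property (POTP), then $T$ is topologically stable.
   Context: $Act(G,X)$ is the set of all continuous actions of $G$ on $X$. A finite generating set $A$ of $G$ is a finite set generating $G$ as a group; it is symmetric if $a\in A$ implies $a^{-1}\in A$. For a finite generating set $A$ and $T,S\in Act(G,X)$, put $d_A(T,S)=\sup_{x\in X,\,a\in A}d(T_ax,S_ax)$, and for $f:X\to X$ put $d(f,\mathrm{Id}_X)=\sup_{x\in X}d(f(x),x)$. $T$ is $A$-topologically stable if for every $\varepsilon>0$ there is $\delta>0$ such that for every $S\in Act(G,X)$ with $d_A(T,S)<\delta$ there is a continuous map $f:X\to X$ with $T_hf=fS_h$ for all $h\in G$ and $d(f,\mathrm{Id}_X)\le\varepsilon$. $T$ is topologically stable if it is $A$-topologically stable for a symmetric finite generating set $A$ of $G$ (this does not depend on the choice of symmetric $A$). A homeomorphism $\phi$ of $X$ is expansive if there is $c>0$ such that $\sup_{n\in\mathbb Z}d(\phi^nx,\phi^ny)>c$ for all $x\neq y$. A homeomorphism $\phi$ has POTP if for every $\varepsilon>0$ there is $\delta>0$ such that for every sequence $\{x_n\}_{n\in\mathbb Z}$ in $X$ with $d(\phi(x_n),x_{n+1})<\delta$ for all $n\in\mathbb Z$ there is $x\in X$ with $d(\phi^n x,x_n)<\varepsilon$ for all $n\in\mathbb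 Z$. *)

(* Defs.v *)
From HB Require Import structures.
From mathcomp Require Import all_boot all_order all_algebra.
From mathcomp Require Import all_classical all_reals all_analysis.

Set Implicit Arguments.
Unset Strict Implicit.
Unset Printing Implicit Defensive.

Import Order.TTheory GRing.Theory Num.Theory.

Local Open Scope classical_set_scope.
Local Open Scope ring_scope.

(* MathComp's theory of subgroups ({group gT}, nilpotent, ...) only covers
   finite groups.  Here G is an arbitrary groupType, and its subsets are
   classical sets. *)
Section Groups.
Context {G : groupType}.
Implicit Types A B H : set G.

Definition subgroup H : Prop :=
  [/\ H 1%g,
      forall x y, H x -> H y -> H (x * y)%g &
      forall x, H x -> H x^-1%g].

Definition generated A : set G := smallest subgroup A.

Definition finite_generating_set A : Prop :=
  finite_set A /\ generated A = setT.

Definition symmetric_set A : Prop := forall a, A a -> A a^-1%g.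

Definition commutator_subgroup A B : set G :=
  generated [set [~ x, y]%g | x in A & y in B].

Fixpoint lower_central_series H (n : nat) : set G :=
  if n is n'.+1 then commutator_subgroup (lower_central_series H n') H else H.

Definition nilpotent_subgroup H : Prop :=
  subgroup H /\ exists n, lower_central_series H n = [set 1%g].

Definition finite_index H : Prop :=
  finite_set [set [set (x * h)%g | h in H] | x in [set: G]].

End Groups.

Definition finitely_generated (G : groupType) : Prop :=
  exists A : set G, finite_generating_set A.

Definition virtually_nilpotent (G : groupType) : Prop :=
  exists H : set G, nilpotent_subgroup H /\ finite_index H.

Record homeomorphism (X : topologicalType) := Homeomorphism {
  homeo_fun :> X -> X;
  homeo_inv : X -> X;
  homeo_funK : cancel homeo_fun homeo_inv;
  homeo_invK : cancel homeo_inv homeo_fun;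
  homeo_fun_continuous : continuous homeo_fun;
  homeo_inv_continuous : continuous homeo_inv
}.

(* Negz n denotes the integer - n.+1. *)
Definition homeo_iter (X : topologicalType) (phi : homeomorphism X) (n : int)
    : X -> X :=
  match n with
  | Posz m => iter m phi
  | Negz m => iter m.+1 (homeo_inv phi)
  end.

(* G carries the discrete topology, so continuity of the action is continuity
   of each map T_g. *)
Record continuous_action (G : groupType) (X : topologicalType) :=
  ContinuousAction {
    act :> G -> X -> X;
    act1 : forall x, act 1%g x = x;
    actM : forall g h x, act (g * h)%g x = act g (act h x);
    act_continuous : forall g, continuous (act g)
  }.

Section ActionHomeomorphism.
Context {G : groupType} {X : topologicalType} (T : continuous_action G X).

Lemma act_invK (g : G) : cancel (T g) (T g^-1%g).
Proof. by move=> x; rewrite -actM mulVg act1. Qed.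

Lemma actK_inv (g : G) : cancel (T g^-1%g) (T g).
Proof. by move=> x; rewrite -actM mulgV act1. Qed.

Definition act_homeo (g : G) : homeomorphism X :=
  Homeomorphism (act_invK g) (actK_inv g)
    (@act_continuous _ _ T g) (@act_continuous _ _ T g^-1%g).

End ActionHomeomorphism.

(* Suprema of distances are taken in \bar R, where they always exist. *)
Section Dynamics.
Context {R : realType} {X : metricType R}.

Definition dist_id (f : X -> X) : \bar R :=
  ereal_sup [set (mdist (f x) x)%:E | x in [set: X]].

Definition expansive (phi : homeomorphism X) : Prop :=
  exists2 c : R, 0 < c &
    forall x y : X, x <> y ->
      (c%:E < ereal_sup [set (mdist (homeo_iter phi n x)
                                    (homeo_iter phi n y))%:E
                        | n in [set: int]])%E.

Definition pseudo_orbit_tracing (phi : homeomorphism X) : Prop :=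
  forall eps : R, 0 < eps -> exists2 delta : R, 0 < delta &
    forall u : int -> X,
      (forall n : int, mdist (phi (u n)) (u (n + 1)) < delta) ->
      exists x : X, forall n : int, mdist (homeo_iter phi n x) (u n) < eps.

Context {G : groupType}.

Definition dist_act (A : set G) (T S : continuous_action G X) : \bar R :=
  ereal_sup [set (mdist (T a x) (S a x))%:E | x in [set: X] & a in A].

Definition topologically_stable_for (A : set G) (T : continuous_action G X)
    : Prop :=
  forall eps : R, 0 < eps -> exists2 delta : R, 0 < delta &
    forall S : continuous_action G X, (dist_act A T S < delta%:E)%E ->
      exists f : X -> X,
        [/\ continuous f,
            forall h : G, T h \o f = f \o S h &
            (dist_id f <= eps%:E)%E].

Definition topologically_stable (T : continuous_action G X) : Prop :=
  exists A : set G,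
    [/\ finite_generating_set A, symmetric_set A &
        topologically_stable_for A T].

End Dynamics.

(* Main.v *)
Require Import Defs.
From mathcomp Require Import all_boot all_order all_algebra.
From mathcomp Require Import zify lra.
From mathcomp Require Import all_classical all_reals all_analysis.

(** Let [g] act expansively with the pseudo-orbit tracing property.  If [S] is
    an action close to [T], every [S g]-orbit is a pseudo-orbit of [T g], hence
    is shadowed by a unique [T g]-orbit; sending a point to the point whose
    orbit shadows its own gives a continuous map [f], close to the identity,
    with [T g \o f = f \o S g] (Walters' argument, [equivariant_map_exists]).
    The theorem amounts to the claim that the subgroup [N] of all [h] with
    [T h \o f = f \o S h], which contains [g], is the whole group.

    Put [k = g ^+ m].  If [k ^ h] is in [N], then [T h \o f \o S h^-1]
    intertwines [S k] and [T k], just as [f] does.  For [h] in a finite set [F]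
    fixed beforehand, this map is moreover close to [f] once [S] is close enough
    to [T], and two close maps that intertwine [S k] and [T k] coincide by
    expansivity ([equivariant_unique]).  So [f = T h \o f \o S h^-1], that is,
    [h] is in [N]: for [h] in [F], membership of [k ^ h] in [N] implies that of
    [h] ([equivariant_map_conj_closed]).

    That a suitable finite [F] and exponent [m] force [N] to be everything is
    pure group theory ([virtually_nilpotent_conj_induction]).  Let [H] be a
    nilpotent subgroup of finite index; it is generated by a finite symmetric
    set [B], and some [m > 0] puts all [m]-th powers in [H].  Let [F] consist of
    generators of the group and of the left-normed commutators of elements of
    [B], of which only those of bounded weight are nontrivial.  If [x] is such a
    commutator, [k ^ x = k * [~ x, k]^-1], and [[~ x, k]] is a product of
    commutators of higher weight and their inverses.  By descending induction on
    the weight, all these commutators are in [N], hence [H] is contained in [N].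
    Finally, for a generator [a] of the group, [k ^ a] is an [m]-th power, so it
    lies in [H], so in [N], and therefore [a] is in [N]. *)

Set Implicit Arguments.
Unset Strict Implicit.
Unset Printing Implicit Defensive.

Import Order.TTheory GRing.Theory Num.Theory.
(* Exposes the metric versions of the distance characterizations of limits. *)
Import metricType_numDomainType.

Local Open Scope classical_set_scope.

(** * Finitely generated virtually nilpotent groups *)

Section GroupTheory.
Local Open Scope group_scope.
Context {G : groupType}.
Implicit Types (A B H M N : set G) (g h k x y : G).

Lemma generated_subgroup A : subgroup (generated A).
Proof.
split=> [M [[]] //|x y Ax Ay M AM|x Ax M AM].
  by have [[_ MM _] _] := AM; apply: MM; [exact: Ax|exact: Ay].
by have [[_ _ MV] _] := AM; apply: MV; exact: Ax.
Qed.

Lemma subgroupX H x n : subgroup H -> H x -> H (x ^+ n).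
Proof.
move=> [H1 HM _] Hx; elim: n => [|n IHn]; first by rewrite expg0.
by rewrite expgS; exact: HM.
Qed.

Lemma finite_set_symmetrize A : finite_set A ->
  exists B, [/\ finite_set B, symmetric_set B & generated B = generated A].
Proof.
move=> finA; exists (A `|` [set x^-1 | x in A]); split.
- by rewrite finite_setU; split=> //; exact: finite_image.
- by move=> x [Ax|[y Ay <-]]; [right; exists x|left; rewrite invgK].
have [_ _ AV] := generated_subgroup A.
apply/seteqP; split; apply: smallest_sub; try exact: generated_subgroup.
  move=> x [Ax|[y Ay <-]]; first exact: sub_gen_smallest.
  by apply: AV; exact: sub_gen_smallest.
by move=> x Ax; apply: sub_gen_smallest; left.
Qed.

Lemma eq_lcoset H x y : subgroup H ->
  [set x * h | h in H] = [set y * h | h in H] -> H (x^-1 * y).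
Proof.
move=> [H1 _ _] /seteqP[_ /(_ y)]; case; first by exists 1; rewrite ?mulg1.
by move=> h Hh <-; rewrite mulKg.
Qed.

(** Among [1, x, ..., x ^+ N], with [N] the number of cosets, two lie in the same
    coset, so [x ^+ d] is in [H] for some [0 < d <= N]; the exponent [N`!] is
    then uniform in [x]. *)
Lemma finite_index_exponent H : subgroup H -> finite_index H ->
  exists2 m, (0 < m)%N & forall x, H (x ^+ m).
Proof.
move=> sgH /finite_seqP[s sE]; exists ((size s)`!); first exact: fact_gt0.
move=> x; pose c i := [set x ^+ i * h | h in H] : set G.
have /uniqPn : ~~ uniq (map c (iota 0 (size s).+1)).
  apply/negP=> /uniq_leq_size /(_ _) le_s.
  suff : (size (map c (iota 0 (size s).+1)) <= size s)%N.
    by rewrite size_map size_iota ltnn.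
  apply: le_s => _ /mapP[i _ ->].
  have : [set [set y * h | h in H] | y in [set: G]] (c i) by exists (x ^+ i).
  by rewrite sE.
move=> /(_ set0)[i [j [ltij]]]; rewrite size_map size_iota => ltj.
have lti := ltn_trans ltij ltj.
rewrite !(nth_map 0%N) ?size_iota// !nth_iota// !add0n => /(eq_lcoset sgH).
rewrite -{1}(subnKC (ltnW ltij)) expgnDr mulKg => Hx.
have /dvdnP[q ->] : (j - i %| (size s)`!)%N.
  by rewrite dvdn_fact// subn_gt0 ltij/= (leq_trans (leq_subr _ _)).
by rewrite mulnC expgnA; exact: subgroupX.
Qed.

(** Schreier's argument: with [R] a finite set of coset representatives, the
    finitely many elements of [H] of the form [s^-1 * (a * t)], [s] and [t] in
    [R] and [a] in [A], let one push a generator through a representative, so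
    that [R] times the subgroup they generate is stable under left
    multiplication by [A], hence is the whole group. *)
Lemma finite_index_finitely_generated A H :
    finite_generating_set A -> symmetric_set A ->
    subgroup H -> finite_index H ->
  exists2 B, finite_set B & generated B = H.
Proof.
move=> [finA genA] symA sgH fiH; have [H1 HM HV] := sgH.
pose rep (C : set G) := xget 1 C.
pose lc x := [set x * h | h in H].
pose r x := rep (lc x).
have rP x : H ((r x)^-1 * x).
  have [h Hh rE] : lc x (r x).
    by apply: (@xgetPex _ 1 (lc x)); exists x, 1; rewrite ?mulg1.
  by rewrite -rE invgM mulgVK; exact: HV.
pose R := rep @` [set lc x | x in [set: G]].
have finR : finite_set R by exact: finite_image.
have Rr x : R (r x) by exists (lc x) => //; exists x.
(* Including [H `&` R] makes it harmless that the representative of [H] itself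
     need not be [1]. *)
pose B := H `&` (R `|`
  [set p.1^-1 * p.2 | p in R `*` [set a * t | a in A & t in R]]).
have sgB := generated_subgroup B; have [B1 BM BV] := sgB.
pose P := [set s * b | s in R & b in generated B].
have BH : generated B `<=` H by apply: smallest_sub => // x [].
have AP a x : A a -> P x -> P (a * x).
  move=> Aa [t Rt [b Bb <-]]; exists (r (a * t)) => //.
  exists ((r (a * t))^-1 * (a * t) * b); last by rewrite -!mulgA mulVKg.
  apply: BM => //; apply: sub_gen_smallest; split; first exact: rP.
  right; exists (r (a * t), a * t) => //; split=> //=.
  by exists a => //; exists t.
have P1 : P (r 1 * (r 1)^-1).
  exists (r 1) => //; exists (r 1)^-1 => //; apply: BV.
  apply: sub_gen_smallest; split; last by left.
  by have := HV _ (rP 1); rewrite mulg1 invgK.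
have PT x : P x.
  rewrite -(mulg1 x) -(mulgV (r 1)).
  have : generated A x by rewrite genA.
  pose Q := [set x | forall y, P y -> P (x * y) /\ P (x^-1 * y)].
  move=> Ax; suff /(_ x Ax _ P1)[] : generated A `<=` Q by [].
  apply: smallest_sub; last first.
    by move=> a Aa y Py; split; apply: AP => //; exact: symA.
  split=> [y Py|u v Qu Qv y Py|u Qu y Py]; first by rewrite invg1 !mul1g.
    rewrite invgM -!mulgA; split; first by apply: (Qu _ _).1; exact: (Qv _ _).1.
    by apply: (Qv _ _).2; exact: (Qu _ _).2.
  by rewrite invgK; have [] := Qu _ Py.
exists B.
  apply: finite_setIr; rewrite finite_setU; split=> //; apply: finite_image.
  by apply: finite_setX => //; exact: finite_image2.
apply/seteqP; split=> // h Hh; have [t Rt [b Bb tbE]] := PT h.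
rewrite -tbE; apply: BM => //; apply: sub_gen_smallest; split; last by left.
have -> : t = h * b^-1 by rewrite -tbE mulgK.
by apply: HM => //; apply: HV; exact: BH.
Qed.

Fixpoint iterated_commutators B i : set G :=
  if i is i'.+1 then [set [~ x, b] | x in iterated_commutators B i' & b in B]
  else B.

(** A substitute for the [i]-th term of the lower central series of
    [generated B], given by explicit generators so that membership in a subgroup
    can be tested on commutators of elements of [B]. *)
Definition commutator_tail B i : set G :=
  generated (\bigcup_(j in [set j | (i <= j)%N]) iterated_commutators B j).

Lemma finite_iterated_commutators B i :
  finite_set B -> finite_set (iterated_commutators B i).
Proof. by move=> finB; elim: i => //= i IHi; exact: finite_image2. Qed.

Lemma iterated_commutators_lcs B i :
  iterated_commutators B i `<=` lower_central_series (generated B) i.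
Proof.
elim: i => [|i IHi]/=; first exact: sub_gen_smallest.
move=> _ [x Fx [b Bb <-]]; apply: sub_gen_smallest.
by exists x; [exact: IHi|exists b => //; exact: sub_gen_smallest].
Qed.

(** In the nilpotent case, this leaves only finitely many commutators of
    generators to consider. *)
Lemma iterated_commutators_eq1 B n j : (n <= j)%N ->
  iterated_commutators B n `<=` [set 1] -> iterated_commutators B j `<=` [set 1].
Proof.
move=> nj Fn; rewrite -(subnKC nj); elim: (j - n)%N => [|d IHd].
  by rewrite addn0.
by rewrite addnS => _ [x /IHd -> [b _ <-]]; rewrite comm1g.
Qed.

(** The tails are normal: for [x] an iterated commutator and [z] in [B],
    [x ^ z = x * [~ x, z]], where the second factor is an iterated commutator one
    step longer; symmetry of [B] covers conjugation by inverses. *)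
Lemma commutator_tailJ B i y h : symmetric_set B -> generated B h ->
  commutator_tail B i y -> commutator_tail B i (y ^ h).
Proof.
move=> symB Bh My; have [M1 MM MV] := generated_subgroup
  (\bigcup_(j in [set j | (i <= j)%N]) iterated_commutators B j).
have MJ z : B z -> commutator_tail B i `<=` [set y | commutator_tail B i (y ^ z)].
  move=> Bz; apply: smallest_sub.
    split=> [|u v Mu Mv|u Mu] /=; first by rewrite conj1g.
      by rewrite conjMg; exact: MM.
    by rewrite conjVg; exact: MV.
  move=> x [j /= ij Fx]; rewrite (_ : x ^ z = x * [~ x, z]); last first.
    by rewrite commgEl mulVKg.
  apply: MM; apply: sub_gen_smallest; first by exists j.
  exists j.+1; first by rewrite /= leqW.
  by exists x => //; exists z.
pose Q := [set h | forall y, commutator_tail B i y ->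
  commutator_tail B i (y ^ h) /\ commutator_tail B i (y ^ h^-1)].
suff /(_ h Bh y My)[] : generated B `<=` Q by [].
apply: smallest_sub; last first.
  by move=> b Bb z Mz; split; apply: MJ => //; exact: symB.
split=> [z Mz|u v Qu Qv z Mz|u Qu z Mz]; first by rewrite invg1 conjg1.
  rewrite invgM !conjgM; split; first by apply: (Qv _ _).1; exact: (Qu _ _).1.
  by apply: (Qu _ _).2; exact: (Qv _ _).2.
by rewrite invgK; have [] := Qu _ Mz.
Qed.

(** Extends the case [h \in B], which holds by construction, through the
    identity [[~ x, u * v] = [~ x, v] * [~ x, u] ^ v] and normality of the
    tail. *)
Lemma commg_tail B i x h : symmetric_set B -> generated B h ->
  iterated_commutators B i x -> commutator_tail B i.+1 [~ x, h].
Proof.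
move=> symB Bh Fx; have [M1 MM MV] := generated_subgroup
  (\bigcup_(j in [set j | (i < j)%N]) iterated_commutators B j).
have [B1 BM BV] := generated_subgroup B.
suff /(_ h Bh)[] : generated B `<=`
  [set h | generated B h /\ commutator_tail B i.+1 [~ x, h]] by [].
apply: smallest_sub; last first.
  move=> b Bb; split; first exact: sub_gen_smallest.
  apply: sub_gen_smallest; exists i.+1; first exact: ltnSn.
  by exists x => //; exists b.
split=> [|u v [Bu Mu] [Bv Mv]|u [Bu Mu]] /=.
- by rewrite commg1.
- split; first exact: BM.
  have -> : [~ x, u * v] = [~ x, v] * [~ x, u] ^ v.
    by rewrite !commgEl conjMg conjgM conjVg -mulgA mulVKg.
  by apply: MM => //; exact: commutator_tailJ.
- split; first exact: BV.
  have -> : [~ x, u^-1] = ([~ x, u]^-1) ^ u^-1.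
    by rewrite !commgEl invgM invgK conjMg conjVg conjgK.
  by apply: commutator_tailJ => //; [exact: BV|exact: MV].
Qed.

(** Descending induction on the length of commutators: for an iterated
    commutator [x], [k ^ x] differs from [k] by an element of the next tail,
    already known to be in [N], and the conjugation hypothesis then yields [x]
    itself. *)
Lemma generated_sub_of_conj B N n k : symmetric_set B ->
    iterated_commutators B n `<=` [set 1] -> generated B k ->
    subgroup N -> N k ->
    (forall i x, (i < n)%N -> iterated_commutators B i x -> N (k ^ x) -> N x) ->
  generated B `<=` N.
Proof.
move=> symB Fn1 Bk sgN Nk Nconj; have [N1 NM NV] := sgN.
suff FN i : commutator_tail B i `<=` N.
  apply: smallest_sub => // b Bb; apply: (FN 0%N); apply: sub_gen_smallest.
  by exists 0%N.
have [d] := ubnP (n - i); elim: d i => // d IHd i le_d.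
apply: smallest_sub => // x [j /= ij Fx].
case: (leqP n j) => [nj|jn].
  by rewrite (iterated_commutators_eq1 nj Fn1 Fx).
have Mj : commutator_tail B j.+1 `<=` N by apply: IHd; lia.
apply: (Nconj j) => //; rewrite (_ : k ^ x = k * [~ x, k]^-1); last first.
  by rewrite invgR commgEl mulVKg.
by apply: NM => //; apply: NV; apply: Mj; exact: commg_tail.
Qed.

(** The group-theoretic half of the proof: [m] and [F] depend only on the group,
    so they can be chosen before the perturbed action, which determines [N]. *)
Lemma virtually_nilpotent_conj_induction A g :
    finite_generating_set A -> symmetric_set A -> virtually_nilpotent G ->
  exists m F, [/\ (0 < m)%N, finite_set F &
    forall N, subgroup N -> N g ->
      (forall h, F h -> N ((g ^+ m) ^ h) -> N h) -> N = [set: G]].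
Proof.
move=> genA symA [H [[sgH [n Hn]] fiH]].
have [m m_gt0 Hm] := finite_index_exponent sgH fiH.
have [B0 finB0 genB0] := finite_index_finitely_generated genA symA sgH fiH.
have [B [finB symB genB]] := finite_set_symmetrize finB0.
rewrite {}genB0 in genB.
exists m, (A `|` \bigcup_(i in `I_n) iterated_commutators B i); split=> //.
  rewrite finite_setU; split; first by case: genA.
  by apply: bigcup_finite => // i _; exact: finite_iterated_commutators.
move=> N sgN Ng Nconj.
have HN : H `<=` N.
  rewrite -genB; apply: (@generated_sub_of_conj _ _ n (g ^+ m)) => //.
  - by rewrite -Hn -genB; exact: iterated_commutators_lcs.
  - by rewrite genB.
  - exact: subgroupX.
  - by move=> i x lt_in Fx; apply: Nconj; right; exists i.
have [_ genAT] := genA; apply/seteqP; split=> // x _.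
have : generated A x by rewrite genAT.
apply: smallest_sub => // a Aa; apply: Nconj; first by left.
by rewrite conjXg; apply: HN.
Qed.

End GroupTheory.

(** * Integer powers *)

Local Open Scope ring_scope.

Section IntegerPowers.
Context {G : groupType}.
Implicit Types (g : G) (n : int).

Definition expgz g n : G :=
  match n with Posz k => (g ^+ k)%g | Negz k => (g ^- k.+1)%g end.

Lemma expgzSl g n : expgz g (n + 1) = (g * expgz g n)%g.
Proof.
case: n => [k|[|k]].
- by rewrite -PoszD addn1 /= expgS.
- by rewrite /= expg1 mulgV.
- have -> : Negz k.+1 + 1 = Negz k by lia.
  by rewrite /= [(g ^+ k.+2)%g]expgSr invgM mulVKg.
Qed.

Lemma expgzSr g n : expgz g (n + 1) = (expgz g n * g)%g.
Proof.
rewrite expgzSl; case: n => k /=; first exact: commuteX.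
by apply: commuteV; exact: commuteX.
Qed.

Lemma expgz_sub (H : set G) g n : subgroup H -> H g -> H (expgz g n).
Proof.
move=> sgH Hg; have [_ _ HV] := sgH.
by case: n => k; [|apply: HV]; exact: subgroupX.
Qed.

(** Euclidean division of the exponent; it bounds [r], so that only finitely
    many maps are involved when passing from [g ^+ m] back to [g]. *)
Lemma expgz_edivn g m n : (0 < m)%N ->
  exists r q, (r < m)%N /\ expgz g n = (g ^+ r * expgz (g ^+ m) q)%g.
Proof.
move=> m_gt0; case: n => k.
  exists (k %% m)%N, (k %/ m)%N; split; first by rewrite ltn_mod.
  by rewrite /= -expgnA -expgnDr mulnC addnC -divn_eq.
(* [j] is a nonnegative number congruent to the exponent [- k.+1] modulo [m]. *)
pose j := (m * k.+1 - k.+1)%N.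
exists (j %% m)%N, (Negz (k - j %/ m)); split; first by rewrite ltn_mod.
have lt_jk : (j %/ m < k.+1)%N by rewrite ltn_divLR//; nia.
have mE : (m * (k - j %/ m).+1 = k.+1 + j %% m)%N.
  have := divn_eq j m; rewrite {1}/j; nia.
by rewrite /= -expgnA mE expgnDr invgM mulVKg.
Qed.

End IntegerPowers.

(** * Topology of compact metric spaces *)

Lemma near_finite_set (T : Type) (I : choiceType) (F : set_system T)
    {FF : Filter F} (D : set I) (P : I -> T -> Prop) : finite_set D ->
  (forall i, D i -> \forall x \near F, P i x) ->
  \forall x \near F, forall i, D i -> P i x.
Proof.
move=> finD PF.
have := @filter_bigI T I (fset_set D) P F FF.
rewrite fset_setK// => H.
by apply: H => i; rewrite in_fset_set// inE; exact: PF.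
Qed.

Section Dynamics.
Context {R : realType} {X : metricType R}.
Context (compactX : compact [set: X]).

(** Heine's theorem, stated for all small [rho] so that finitely many instances
    combine by intersecting neighborhoods. *)
Lemma near_unif_continuous (h : X -> X) (eta : R) : continuous h -> 0 < eta ->
  \forall rho \near 0^'+, forall x y, mdist x y < rho -> mdist (h x) (h y) < eta.
Proof.
move=> ch eta0.
suff : \forall rho \near (0 : R)^'+, [set: X] `<=`
    [set x | forall y, mdist x y < rho -> mdist (h x) (h y) < eta].
  by apply: filterS => rho H x y; exact: (H x).
apply: (iffLR (compact_near_coveringP _) compactX) => x _.
have e20 : 0 < eta / 2 by rewrite divr_gt0.
have /cvgrPdist_lt/(_ _ e20)/nbhs_mdistP[r /= r0 xr] := ch x.
have r20 : 0 < r / 2 by rewrite divr_gt0.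
exists ([set x' | mdist x x' < r / 2], [set rho | rho < r / 2]).
  split => /=; last exact: nbhs_right_lt.
  by apply/nbhs_mdistP; exists (r / 2).
move=> [x' rho] /= [xx' rho_lt] y x'y.
have := xr x'; have := xr y => /=.
have := metric_triangle x x' y; have := metric_triangle (h x') (h x) (h y).
rewrite (metric_sym (h x') (h x)) => t1 t2 h1 h2.
have {}h1 : mdist (h x) (h y) < eta / 2 by apply: h1; lra.
have {}h2 : mdist (h x) (h x') < eta / 2 by apply: h2; lra.
lra.
Qed.

Lemma near_right_ex (P : R -> Prop) :
  (\forall e \near 0^'+, P e) -> exists2 e, 0 < e & P e.
Proof.
move=> nP; have : \forall e \near (0 : R)^'+, 0 < e /\ P e.
  by apply: filterI => //; exact: nbhs_right_gt.
by move=> /filter_ex[e []]; exists e.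
Qed.

(** Closed graph theorem with compact codomain.  The graph is presented by an
    arbitrary relation with open complement, because the shadowing relation
    below is more tractable than the function chosen from it. *)
Lemma continuous_of_closed_graph (P : X -> X -> Prop) (f : X -> X) :
  (forall x, P x (f x)) -> (forall x z, P x z -> z = f x) ->
  (forall x z, ~ P x z -> \forall z' \near z & x' \near x, ~ P x' z') ->
  continuous f.
Proof.
move=> Pf Puniq Pcl x; apply/cvgrPdist_lt => eta eta0.
suff : \forall x' \near x, [set: X] `<=`
    [set z | P x' z -> mdist (f x) z < eta].
  by apply: filterS => x' H; exact: H.
apply: (iffLR (compact_near_coveringP _) compactX) => z _.
have [Pxz|nPxz] := pselect (P x z).
  rewrite (Puniq _ _ Pxz).
  exists ([set z' | mdist (f x) z' < eta], setT) => /=; last by move=> ? [].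
  by split; [apply/nbhs_mdistP; exists eta|exact: filterT].
by apply: filterS (Pcl _ _ nPxz) => -[z' x'] /= nP /nP.
Qed.

(** * Perturbations of an action *)

Context {G : groupType}.
Implicit Types T S : continuous_action G X.

Lemma homeo_iter_act T g n x : homeo_iter (act_homeo T g) n x = T (expgz g n) x.
Proof.
have iterT h k : iter k (T h) x = T (h ^+ k)%g x.
  elim: k => [|k /= ->]; first by rewrite expg0 act1.
  by rewrite -actM expgS.
case: n => k; first exact: iterT.
by rewrite /homeo_iter iterT /= -expVgn.
Qed.

Definition expansivity_constant T g (c : R) : Prop :=
  forall x y, (forall n, mdist (T (expgz g n) x) (T (expgz g n) y) <= c) -> x = y.

Lemma expansive_act T g : expansive (act_homeo T g) ->
  exists2 c, 0 < c & expansivity_constant T g c.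
Proof.
move=> [c c0 expc]; exists c => // x y xy; apply: contrapT => /expc.
rewrite ltNge => /negP; apply; apply: ge_ereal_sup => _ [n _ <-].
by rewrite !homeo_iter_act lee_fin.
Qed.

(** Closeness on generators propagates to each element: products and inverses
    are handled by uniform continuity of the maps of the fixed action [T], so
    the estimate is uniform in [S]. *)
Lemma near_dist_act T (A : set G) h (eta : R) : generated A h -> 0 < eta ->
  \forall delta \near 0^'+, forall S, (dist_act A T S < delta%:E)%E ->
    forall x, mdist (T h x) (S h x) < eta.
Proof.
move=> Ah; move: eta.
pose Q := [set h | forall eta : R, 0 < eta -> \forall delta \near 0^'+,
  forall S, (dist_act A T S < delta%:E)%E ->
    forall x, mdist (T h x) (S h x) < eta].
suff : generated A `<=` Q by apply.
apply: smallest_sub; last first.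
  move=> a Aa eta eta0; near=> delta => S dS x.
  rewrite -lte_fin; apply: (@lt_trans _ _ delta%:E).
    by apply: le_lt_trans dS; apply: ereal_sup_ubound; exists x => //; exists a.
  by rewrite lte_fin; near: delta; exact: nbhs_right_lt.
split=> [eta eta0|g k Qg Qk eta eta0|k Qk eta eta0].
- by near=> delta => S _ x; rewrite !act1 mdistxx.
- have e20 : 0 < eta / 2 by rewrite divr_gt0.
  have [rho rho0 Trho] := near_right_ex
    (near_unif_continuous (@act_continuous _ _ T g) e20).
  apply: filterS2 (Qg _ e20) (Qk _ rho0) => delta Hg Hk S dS x; rewrite !actM.
  have h1 := Trho _ _ (Hk S dS x); have h2 := Hg S dS (S k x).
  have := metric_triangle (T g (T k x)) (T g (S k x)) (S g (S k x)); lra.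
- have [rho rho0 Trho] := near_right_ex
    (near_unif_continuous (@act_continuous _ _ T k^-1%g) eta0).
  apply: filterS (Qk _ rho0) => delta H S dS x.
  rewrite -{1}(actK_inv S k x) -{2}(act_invK T k (S k^-1%g x)).
  by apply: Trho; rewrite metric_sym; exact: H.
Unshelve. all: by end_near. Qed.

Definition equivariance T S (f : X -> X) : set G := [set h | T h \o f = f \o S h].

Lemma equivariance_subgroup T S f : subgroup (equivariance T S f).
Proof.
split=> [|g h Ng Nh|g Ng]; apply/funext => x /=.
- by rewrite !act1.
- have /(congr1 (@^~ (S h x))) /= := Ng; have /(congr1 (@^~ x)) /= := Nh.
  by rewrite !actM => -> ->.
- have /(congr1 (@^~ (S g^-1%g x))) /= := Ng.
  by rewrite actK_inv => <-; rewrite act_invK.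
Qed.

(** If the two maps are close enough, so are their compositions with [T (g ^+ r)]
    for the finitely many [r < m].  As they intertwine the powers of [g ^+ m],
    the [T g]-orbits of [f1 x] and [f2 x] stay within the expansivity constant,
    hence the two points agree.  Only the power [g ^+ m] is required to be
    respected, as only powers of [g] are known to lie in the nilpotent
    subgroup. *)
Lemma equivariant_unique T g (c : R) m :
    0 < c -> expansivity_constant T g c -> (0 < m)%N ->
  exists2 c' : R, 0 < c' & forall S f1 f2,
    equivariance T S f1 (g ^+ m)%g -> equivariance T S f2 (g ^+ m)%g ->
    (forall x, mdist (f1 x) (f2 x) < c') -> f1 = f2.
Proof.
move=> c0 expc m_gt0.
have [rho rho0 Trho] : exists2 rho : R, 0 < rho & forall r, (r < m)%N ->
    forall x y, mdist x y < rho -> mdist (T (g ^+ r)%g x) (T (g ^+ r)%g y) < c.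
  apply: near_right_ex; apply: (near_finite_set (finite_II m)) => r _.
  exact: (near_unif_continuous (@act_continuous _ _ T _) c0).
exists rho => // S f1 f2 N1 N2 f12; apply/funext => x; apply: expc => n.
have [r [q [lt_rm ->]]] := expgz_edivn g n m_gt0.
rewrite !actM; apply/ltW/Trho => //.
have /(congr1 (@^~ x)) /= -> := expgz_sub q (equivariance_subgroup T S f1) N1.
have /(congr1 (@^~ x)) /= -> := expgz_sub q (equivariance_subgroup T S f2) N2.
exact: f12.
Qed.

(** Walters' stability argument: [f x] is the point whose [T g]-orbit shadows the
    [S g]-orbit of [x].  Since [eps + eps <= c], it is the only one, even for
    non-strict shadowing, which is a closed condition; uniqueness gives the
    equivariance, and with the closed graph theorem the continuity. *)
Lemma equivariant_map_exists T g (c eps : R) :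
    expansivity_constant T g c -> pseudo_orbit_tracing (act_homeo T g) ->
    0 < eps -> eps + eps <= c ->
  exists2 delta : R, 0 < delta & forall S,
    (forall x, mdist (T g x) (S g x) < delta) ->
    exists f, [/\ continuous f, equivariance T S f g &
                  forall x, mdist (f x) x < eps].
Proof.
move=> expc /[apply] -[delta delta0 potp] eps_c.
exists delta => // S TS.
pose shadow x z := forall n, mdist (T (expgz g n) z) (S (expgz g n) x) <= eps.
have ex_f x : exists z, forall n, mdist (T (expgz g n) z) (S (expgz g n) x) < eps.
  have [|z xz] := potp (fun n => S (expgz g n) x).
    by move=> n; rewrite /= expgzSl actM.
  by exists z => n; rewrite -homeo_iter_act.
have [f fP] := choice ex_f.
have fS x : shadow x (f x) by move=> n; exact/ltW.
have shadow_uniq x z : shadow x z -> z = f x.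
  move=> xz; apply: expc => n.
  apply: le_trans (metric_triangle _ (S (expgz g n) x) _) _.
  by rewrite (metric_sym (S _ _)) (le_trans _ eps_c)// lerD// fS.
exists f; split.
- apply: (continuous_of_closed_graph fS shadow_uniq) => x z /existsNP[n].
  move=> /negP; rewrite -ltNge => eps_lt.
  pose e := (mdist (T (expgz g n) z) (S (expgz g n) x) - eps) / 2.
  have e0 : 0 < e by rewrite divr_gt0// subr_gt0.
  have /cvgrPdist_lt/(_ _ e0) nz := @act_continuous _ _ T (expgz g n) z.
  have /cvgrPdist_lt/(_ _ e0) nx := @act_continuous _ _ S (expgz g n) x.
  exists ([set z' | mdist (T (expgz g n) z) (T (expgz g n) z') < e],
          [set x' | mdist (S (expgz g n) x) (S (expgz g n) x') < e]) => //.
  move=> [z' x'] /= [zz' xx'] /(_ n).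
  have := metric_triangle (T (expgz g n) z) (T (expgz g n) z') (S (expgz g n) x).
  have := metric_triangle (T (expgz g n) z') (S (expgz g n) x') (S (expgz g n) x).
  rewrite (metric_sym (S (expgz g n) x')); rewrite /e in zz' xx'; lra.
- apply/funext => x /=; apply: shadow_uniq => n.
  by rewrite -!actM -expgzSr; exact: fS.
- by move=> x; have := fP x 0; rewrite /= expg0 !act1.
Qed.

(** [T g \o T h = T h \o T (g ^ h)], and likewise for [S], so conjugating [f] by
    [h] trades [g ^ h] for [g]. *)
Lemma equivariance_conj T S f g h :
  equivariance T S f (g ^ h)%g ->
  equivariance T S (T h \o f \o S h^-1%g) g.
Proof.
move=> Ngh; apply/funext => x /=.
have /(congr1 (@^~ (S h^-1%g x))) /= := Ngh.
rewrite -!actM conjgE => /(congr1 (T h)).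
by rewrite -!actM mulVKg mulgA mulgK.
Qed.

(** The dynamical half of the proof: [delta] is small enough for
    [T h \o f \o S h^-1] to be within the uniqueness radius of [f] for all [h] in
    [F]. *)
Lemma equivariant_map_conj_closed T g m (F : set G) (A : set G) :
    expansive (act_homeo T g) -> pseudo_orbit_tracing (act_homeo T g) ->
    (0 < m)%N -> finite_set F -> generated A = [set: G] ->
  forall eps : R, 0 < eps -> exists2 delta : R, 0 < delta &
    forall S, (dist_act A T S < delta%:E)%E ->
    exists f, [/\ continuous f, forall x, mdist (f x) x < eps,
      equivariance T S f g &
      forall h, F h -> equivariance T S f ((g ^+ m) ^ h)%g ->
        equivariance T S f h].
Proof.
move=> /expansive_act[c c0 expc] potp m_gt0 finF genA eps eps0.
have [c' c'0 uniq] := equivariant_unique c0 expc m_gt0.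
have c'30 : 0 < c' / 3 by rewrite divr_gt0.
have c20 : 0 < c / 2 by rewrite divr_gt0.
(* The distance from [T h (f y)] to [f (S h y)] is split at [T h y] and
     [S h y], each of the three pieces being allotted [c' / 3]. *)
have [e e0 [[e_eps e_c] [e_c' Te]]] : exists2 e : R, 0 < e &
    (e < eps /\ e < c / 2) /\ (e < c' / 3 /\ forall h, F h -> forall x y,
      mdist x y < e -> mdist (T h x) (T h y) < c' / 3).
  apply: near_right_ex; apply: filterI; apply: filterI.
  - exact: nbhs_right_lt.
  - exact: nbhs_right_lt.
  - exact: nbhs_right_lt.
  - apply: (near_finite_set (F := (0 : R)^'+) finF) => h _.
    exact: (near_unif_continuous (@act_continuous _ _ T _) c'30).
have e_c2 : e + e <= c by lra.
have [d d0 mapS] := equivariant_map_exists expc potp e0 e_c2.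
have genT h : generated A h by rewrite genA.
have [delta delta0 [Sg SF]] : exists2 delta : R, 0 < delta &
    (forall S, (dist_act A T S < delta%:E)%E ->
       forall x, mdist (T g x) (S g x) < d) /\
    (forall h, F h -> forall S, (dist_act A T S < delta%:E)%E ->
       forall x, mdist (T h x) (S h x) < c' / 3).
  apply: near_right_ex; apply: filterI; first exact: near_dist_act.
  apply: (near_finite_set (F := (0 : R)^'+) finF) => h _.
  exact: near_dist_act.
exists delta => // S TS; have [f [cf Nfg fe]] := mapS S (Sg _ TS).
exists f; split=> // [x|h Fh Nkh]; first exact: lt_trans (fe x) e_eps.
have sgN := equivariance_subgroup T S f.
have ff : T h \o f \o S h^-1%g = f.
  apply: (uniq S); first exact: equivariance_conj.
    exact: subgroupX.
  move=> x /=; set y := S h^-1%g x; have -> : x = S h y by rewrite /y actK_inv.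
  have h1 := Te h Fh _ _ (fe y); have h2 := SF h Fh S TS y; have h3 := fe (S h y).
  rewrite metric_sym in h3.
  have := metric_triangle (T h (f y)) (T h y) (f (S h y)).
  have := metric_triangle (T h y) (S h y) (f (S h y)).
  lra.
by apply/funext => x /=; rewrite -{2}ff /= act_invK.
Qed.

End Dynamics.

(** * Topological stability *)

Local Close Scope ring_scope.

Theorem theorem2p11 (R : realType) (G : groupType) (X : metricType R)
    (T : continuous_action G X) :
  finitely_generated G ->
  virtually_nilpotent G ->
  compact [set: X] ->
  (exists g : G, expansive (act_homeo T g) /\
                 pseudo_orbit_tracing (act_homeo T g)) ->
  topologically_stable T.
Proof.
move=> [A0 [finA0 genA0]] vnG cX [g [expg potpg]].
have [A [finA symA genA]] := finite_set_symmetrize finA0.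
rewrite genA0 in genA.
have [m [F [m_gt0 finF FN]]] := virtually_nilpotent_conj_induction g
  (conj finA genA) symA vnG.
exists A; split=> // eps eps0.
have [delta delta0 mapS] := equivariant_map_conj_closed cX expg potpg m_gt0
  finF genA eps0.
exists delta => // S /mapS[f [cf fe Nfg NF]]; exists f; split=> //.
  move=> h; suff : equivariance T S f h by [].
  by rewrite (FN _ (equivariance_subgroup T S f) Nfg NF).
by apply: ge_ereal_sup => _ [x _ <-]; rewrite lee_fin ltW.
Qed.
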